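(* Let $G$ be a finite simple graph, let $\ell$ be an integer with $1\le \ell\le |V(G)|$, and let $B\subseteq V(G)$. Then $B$ is an $\ell$-leaky forcing set of $G$ if and only if $B$ is an $(\ell-1)$-leaky forcing set of $G$ such that for every set $L\subseteq V(G)$ of $\ell-1$ leaks and every $v\in V(G)\setminus B$ there exist $x\to v,\ y\to v\in \mathcal F_L(B)$ with $x\neq y$.
   Context: Zero forcing color change rule: starting from a set of blue vertices (all others white), a blue vertex $u$ may force (color blue) a white vertex $v$ if $v$ is the only white neighbor of $u$; this force is denoted $u\to v$. A leak is a vertex that is not allowed to perform a force. For an integer $0\le \ell\le |V(G)|$, a set $B\subseteq V(G)$ is an $\ell$-leaky forcing set of $G$ if, for every set $L\subseteq V(G)$ with $|L|=\ell$, starting with exactly $B$ blue and iteratively applying the color change rule, with vertices of $L$ not allowed to force, eventually colors all of $V(G)$ blue. A set of forces (forcing process) $F$ of $B$ in $G$ is a set of forces admitting a chronological ordering such that, starting with exactly $B$ blue, each force is valid when performed (it colors a vertex that is white at that time) and at the end all of $V(G)$ is blue. For a set of leaks $L\subseteq V(G)$, $\mathcal F_L(B)$ is the set of all forces possible with initial blue set $B$ and leaks $L$: $u\to v\in\mathcal F_L(B)$ if and only if there is a set of forces $F$ of $B$ in $G$ containing $u\to v$ such that no force in $F$ is performed by a vertex of $L$ (in particular $u\notin L$). *)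

(* Defs.v *)
From mathcomp Require Import all_boot.

Set Implicit Arguments.
Unset Strict Implicit.
Unset Printing Implicit Defensive.

(* A finite simple graph is a symmetric irreflexive relation [e] on a finType
   [T]; a set of vertices [S : {set T}] is read as the set of blue vertices,
   and a force u -> v is the pair [(u, v)]. *)

Definition can_force (T : finType) (e : rel T) (S : {set T}) (u v : T) : bool :=
  [&& u \in S, v \notin S, e u v &
      [forall w, e u w && (w \notin S) ==> (w == v)]].

Definition color_change (T : finType) (e : rel T) (L : {set T}) :
    rel {set T} :=
  fun S S' =>
    [exists u, exists v, [&& u \notin L, can_force e S u v & S' == v |: S]].

(* More blue vertices never block a force other than by having already coloured
   its target, so the final colouring does not depend on the order of the
   forces: reachability of [setT] is the same as every maximal run of the rule
   ending in [setT]. *)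
Definition leaky_forcing (T : finType) (e : rel T) (l : nat) (B : {set T}) :
    Prop :=
  forall L : {set T}, #|L| = l -> connect (color_change e L) B [set: T].

Fixpoint chronological (T : finType) (e : rel T) (S : {set T})
    (s : seq (T * T)) : bool :=
  if s is (u, v) :: s' then can_force e S u v && chronological e (v |: S) s'
  else S == [set: T].

Definition set_of_forces (T : finType) (e : rel T) (B : {set T})
    (F : {set T * T}) : Prop :=
  exists s : seq (T * T), F =i s /\ chronological e B s.

Definition possible_force (T : finType) (e : rel T) (L B : {set T})
    (u v : T) : Prop :=
  exists F : {set T * T},
    [/\ set_of_forces e B F, (u, v) \in F
      & forall p, p \in F -> p.1 \notin L].

(* Main.v *)
(* If the colouring with leaks [L] gets stuck at [S], drop a leak [a] from [L]:
   every forcing process avoiding [L :\ a] must leave [S], and it can only do so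
   through the force by [a] of its unique white neighbour [w]. Hence [a -> w] is
   the only possible force of [w], so two forces of [w] cannot coexist.
   Conversely, given a force [x -> v], leaking [x] as well yields another one. *)
Require Import Defs.
From mathcomp Require Import all_boot.

Set Implicit Arguments.
Unset Strict Implicit.

Lemma can_force_mono (T : finType) (e : rel T) (A S : {set T}) u v :
  A \subset S -> v \notin S -> can_force e A u v -> can_force e S u v.
Proof.
move=> /subsetP sAS vS /and4P[uA _ euv /forallP uniq_v].
apply/and4P; split=> //; first exact: sAS.
apply/forallP=> w; apply/implyP=> /andP[euw wS].
by apply: (implyP (uniq_v w)); rewrite euw; apply: contra wS; apply: sAS.
Qed.

Lemma can_force_fun (T : finType) (e : rel T) (S : {set T}) u v w :
  can_force e S u v -> can_force e S u w -> v = w.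
Proof.
case/and4P=> _ vS euv _ /and4P[_ _ _ /forallP/(_ v)].
by rewrite euv vS => /eqP.
Qed.

(** Consider the first force of [s] whose target lies outside [S]. Until then every blue vertex is
    in [S], and enlarging the blue set to [S] leaves this force valid because its target is still
    white. *)
Lemma chronological_exit (T : finType) (e : rel T) s (A S : {set T}) :
    A \subset S -> S != [set: T] -> chronological e A s ->
  exists2 p, p \in s & can_force e S p.1 p.2.
Proof.
elim: s A => [|[u v] s IHs] A sAS nST /=.
  by move/eqP=> defA; rewrite -subTset -defA sAS in nST.
case/andP=> Auv chr_s; have [vS | vS] := boolP (v \in S).
  have sA'S: v |: A \subset S by rewrite subUset sub1set vS.
  by have [p ps Sp] := IHs _ sA'S nST chr_s; exists p; rewrite ?inE ?ps ?orbT.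
by exists (u, v); rewrite ?mem_head //; apply: can_force_mono Auv.
Qed.

Lemma chronological_target (T : finType) (e : rel T) s (A : {set T}) u v :
  chronological e A s -> (u, v) \in s -> v \notin A.
Proof.
elim: s A => [//|[u' v'] s IHs] A /= /andP[/and4P[_ v'A _ _] chr_s].
rewrite inE => /predU1P[[_ ->] // | /(IHs _ chr_s)].
by rewrite !inE negb_or => /andP[].
Qed.

(** A target is white when it is forced and blue ever after, so no later force of the process can
    hit it again. *)
Lemma chronological_inj (T : finType) (e : rel T) s (A : {set T}) x y v :
  chronological e A s -> (x, v) \in s -> (y, v) \in s -> x = y.
Proof.
elim: s A => [//|[u w] s IHs] A /= /andP[_ chr_s].
have nws z : (z, w) \notin s.
  by apply/negP=> /(chronological_target chr_s); rewrite setU11.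
rewrite !inE => /predU1P[[-> ->] | xs] /predU1P[|]; last exact: (IHs _ chr_s).
- by case.
- by rewrite (negPf (nws y)).
by case=> _ defv; rewrite defv (negPf (nws x)) in xs.
Qed.

Lemma chronological_forced (T : finType) (e : rel T) s (A : {set T}) v :
  chronological e A s -> v \notin A -> exists u, (u, v) \in s.
Proof.
elim: s A => [|[u w] s IHs] A /=; first by move/eqP->; rewrite inE.
case/andP=> _ chr_s vA; have [-> | nvw] := eqVneq v w.
  by exists u; rewrite mem_head.
have vA' : v \notin w |: A by rewrite !inE negb_or nvw.
by have [x xs] := IHs _ chr_s vA'; exists x; rewrite inE xs orbT.
Qed.

(** Bridge between the two models of forcing: the edges of a path between colourings, read in order,
    are the forces of a process that avoids the leaks. *)
Lemma connect_chronological (T : finType) (e : rel T) (L A : {set T}) :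
    connect (color_change e L) A [set: T] <->
  exists2 s, chronological e A s & forall p, p \in s -> p.1 \notin L.
Proof.
split=> [/connectP[t] | [s]].
  elim: t A => [|S t IHt] A /=; first by move=> _ <-; exists [::] => //=.
  case/andP=> /existsP[u /existsP[v /and3P[uL Auv /eqP->]]] + defT.
  case/IHt=> // s chr_s sL; exists ((u, v) :: s); first by rewrite /= Auv.
  by move=> p; rewrite inE => /predU1P[-> | /sL].
elim: s A => [|[u v] s IHs] A /=; first by move=> /eqP-> _; apply: connect0.
case/andP=> Auv chr_s sL; apply: connect_trans (IHs _ chr_s _) => [|p ps].
  apply/connect1/existsP; exists u; apply/existsP; exists v.
  by rewrite Auv eqxx (sL (u, v)) ?mem_head.
by apply: sL; rewrite inE ps orbT.
Qed.

Lemma connect_color_change_subset (T : finType) (e : rel T)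
    (L L' A : {set T}) :
    L \subset L' -> connect (color_change e L') A [set: T] ->
  connect (color_change e L) A [set: T].
Proof.
move=> /subsetP sLL' /connect_chronological[s chr_s sL'].
by apply/connect_chronological; exists s => // p /sL'; apply/contra/sLL'.
Qed.

(** Take [S] of largest cardinality among the reachable supersets of [A]: a force from [S] by a
    vertex outside [L] would reach a larger one. *)
Lemma color_change_closure (T : finType) (e : rel T) (L A : {set T}) :
  exists S : {set T}, [/\ A \subset S, connect (color_change e L) A S
    & forall u v, can_force e S u v -> u \in L].
Proof.
pose P (S : {set T}) := (A \subset S) && connect (color_change e L) A S.
have PA : P A by rewrite /P subxx connect0.
case: (arg_maxnP (fun S : {set T} => #|S|) PA) => S /andP[sAS cAS] maxS.
exists S; split=> // u v Suv; apply/negPn/negP=> uL.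
have vS : v \notin S by case/and4P: Suv.
have : P (v |: S).
  rewrite /P (subset_trans sAS) ?subsetUr //; apply: connect_trans cAS _.
  by apply/connect1/existsP; exists u; apply/existsP; exists v; rewrite uL Suv /=.
by move/maxS; rewrite /= cardsU1 vS add1n ltnn.
Qed.

Lemma possible_forceP (T : finType) (e : rel T) (L A : {set T}) u v :
    possible_force e L A u v <->
  exists s, [/\ chronological e A s, (u, v) \in s
    & forall p, p \in s -> p.1 \notin L].
Proof.
split=> [[F [[s [defF chr_s]] Fuv FL]] | [s [chr_s suv sL]]].
  by exists s; split=> // [|p]; rewrite -defF //; apply: FL.
exists [set p in s]; split=> [||p]; rewrite ?inE //; last exact: sL.
by exists s; split=> // p; rewrite inE.
Qed.

Lemma possible_force_exists (T : finType) (e : rel T) (L A : {set T}) v :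
    connect (color_change e L) A [set: T] -> v \notin A ->
  exists2 u, u \notin L & possible_force e L A u v.
Proof.
move=> /connect_chronological[s chr_s sL] /(chronological_forced chr_s)[u us].
by exists u; [apply: (sL _ us) | apply/possible_forceP; exists s].
Qed.

Lemma possible_force_subset (T : finType) (e : rel T) (L L' A : {set T}) u v :
  L \subset L' -> possible_force e L' A u v -> possible_force e L A u v.
Proof.
by move=> /subsetP sLL' [F [Fs Fuv FL']]; exists F; split=> // p /FL'; apply/contra/sLL'.
Qed.

Theorem theorem2p5 (T : finType) (e : rel T)
    (e_sym : symmetric e) (e_irr : irreflexive e)
    (l : nat) (l_ge1 : 1 <= l) (l_le : l <= #|T|) (B : {set T}) :
  leaky_forcing e l B <->
  leaky_forcing e (l - 1) B /\
  (forall L : {set T}, #|L| = l - 1 ->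
     forall v : T, v \notin B ->
       exists x y : T,
         [/\ possible_force e L B x v, possible_force e L B y v & x <> y]).
Proof.
have cardU1 (L : {set T}) x : #|L| = l - 1 -> x \notin L -> #|x |: L| = l.
  by move=> cL xL; rewrite cardsU1 xL cL add1n subn1 prednK.
split=> [leakB | [leakB twoB] L cL].
  have leakB' : leaky_forcing e (l - 1) B.
    (* As [l - 1 < #|T|], some vertex lies outside [L] and can be added to bring the number of leaks
       up to exactly [l]. *)
    move=> L cL; have /set0Pn[x] : ~: L != set0.
      by rewrite -card_gt0 cardsCs setCK cL subn_gt0 subn1 prednK.
    rewrite inE => xL; apply: (connect_color_change_subset (subsetUr [set x] L)).
    by apply: leakB; apply: cardU1.
  split=> // L cL v vB.
  have [x xL Lx] := possible_force_exists (leakB' L cL) vB.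
  (* With [x] leaked as well, [v] is still forced, necessarily by a vertex other than [x]. *)
  have [y] := possible_force_exists (leakB _ (cardU1 L x cL xL)) vB.
  rewrite !inE negb_or => /andP[/eqP nyx _] Ly.
  exists x, y; split=> //; last exact/nesym.
  exact: possible_force_subset (subsetUr _ _) Ly.
have [S [sBS cBS closedS]] := color_change_closure e L B.
have [<- // | nST] := eqVneq S [set: T].
have /set0Pn[a aL] : L != set0 by rewrite -card_gt0 cL.
have cL' : #|L :\ a| = l - 1 by rewrite -cL (cardsD1 a L) aL addKn.
(* The force leaving [S] is performed by a vertex of [L], since [S] is closed, but not by one of
   [L :\ a]; only [a] remains. *)
have exitS s : chronological e B s -> (forall p, p \in s -> p.1 \notin L :\ a) ->
    exists2 w, (a, w) \in s & can_force e S a w.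
  move=> chr_s sL'; have [[u w] us Suw] := chronological_exit sBS nST chr_s.
  have := sL' _ us; rewrite !inE (closedS _ _ Suw) andbT negbK => /eqP/= defu.
  by exists w; rewrite -defu.
(* This one process serves to produce [w]; any other process exits [S] through the same [w], because
   [a] has a single white neighbour with respect to [S]. *)
have [s chr_s sL'] := (connect_chronological e (L :\ a) B).1 (leakB _ cL').
have [w _ Saw] := exitS s chr_s sL'.
have wB : w \notin B.
  by case/and4P: Saw => _ wS _ _; apply: contra wS; apply/subsetP.
have only_a z : possible_force e (L :\ a) B z w -> z = a.
  case/possible_forceP=> t [chr_t tzw tL'].
  have [w' taw' Saw'] := exitS t chr_t tL'.
  rewrite -(can_force_fun Saw Saw') in taw'.
  exact: chronological_inj chr_t tzw taw'.
by have [x [y [/only_a-> /only_a-> []]]] := twoB _ cL' w wB.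
Qed.
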